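(* The right Kasch and right dual Kasch conditions are invariant under Morita equivalence: if $R$ and $S$ are Morita equivalent rings, then $R$ is right Kasch if and only if $S$ is right Kasch, and $R$ is right dual Kasch if and only if $S$ is right dual Kasch.
   Context: Rings are associative, unital and non-trivial; modules are unital. A ring $R$ is right Kasch if every simple right $R$-module embeds into $R$, and right dual Kasch if every simple right $R$-module is isomorphic to a factor module of an injective right $R$-module. Morita equivalent means that the categories of right $R$-modules and right $S$-modules are equivalent. *)

(* Defs.v *)
(* Modules over an nzRingType A in MathComp are left A-modules.  A right
   R-module is a left module over the converse ring R^c: writing m . r for
   (r : R^c) *: m, the axiom scalerA reads m . (r * s) = (m . r) . s, with
   r * s the product of R.

   Morphisms of modules are compared pointwise (=1).

   Submodules are MathComp's submodClosed predicates, which are boolean; in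
   the intended classical reading (excluded middle, choice) every subset is
   given by such a predicate, and every module carries the choice structure
   demanded by lmodType. *)
From HB Require Import structures.
From mathcomp Require Import all_boot all_order all_algebra.

Set Implicit Arguments.
Unset Strict Implicit.
Unset Printing Implicit Defensive.

Import GRing.Theory.
Local Open Scope ring_scope.
Local Open Scope quotient_scope.

Notation rmodType R := (lmodType R^c).

(* R as a right module over itself: (a : R^c) *: x = x * a. *)
Definition regular_rmod (R : nzRingType) : rmodType R := (R^c)^o.

Section FactorModule.
Variables (A : nzRingType) (M : lmodType A) (N : submodClosed M).

(* submodClosed only records closure under + and *: ; over a ring, closure
   under opposite follows. *)
Definition submod_pred : {pred M} := [pred x | x \in N].

Fact submod_pred_zmod_closed : zmod_closed submod_pred.
Proof. exact: GRing.submod_closedB (submodClosedP N). Qed.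

HB.instance Definition _ :=
  GRing.isZmodClosed.Build M submod_pred submod_pred_zmod_closed.

Fact submod_pred_scaler_closed : GRing.scaler_closed submod_pred.
Proof. by move=> a x; exact: rpredZ. Qed.

HB.instance Definition _ :=
  GRing.isScaleClosed.Build A M submod_pred submod_pred_scaler_closed.

Definition factor_mod : Type := Quotient.quot submod_pred.

HB.instance Definition _ := ZmodQuotient.on factor_mod.

Definition factor_scale (a : A) : factor_mod -> factor_mod :=
  lift_op1 factor_mod ( *:%R a).

Lemma pi_factor_scale a :
  {morph \pi_factor_mod : x / a *: x >-> factor_scale a x}.
Proof.
move=> x; unlock factor_scale; apply/eqP.
have xK : (x - repr (\pi_factor_mod x)) \in submod_pred.
  by rewrite Quotient.idealrBE reprK.
by rewrite -Quotient.idealrBE -scalerBr rpredZ.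
Qed.

Lemma factor_scaleA a b x :
  factor_scale a (factor_scale b x) = factor_scale (a * b) x.
Proof. by elim/quotW: x => x; rewrite -!pi_factor_scale scalerA. Qed.

Lemma factor_scale1 : left_id 1 factor_scale.
Proof. by elim/quotW=> x; rewrite -pi_factor_scale scale1r. Qed.

Lemma factor_scaleDr : right_distributive factor_scale +%R.
Proof.
move=> a; elim/quotW=> x; elim/quotW=> y.
by rewrite -!raddfD -!pi_factor_scale -raddfD scalerDr.
Qed.

Lemma factor_scaleDl x : {morph factor_scale^~ x : a b / a + b}.
Proof.
by elim/quotW: x => x a b; rewrite -!pi_factor_scale -raddfD scalerDl.
Qed.

HB.instance Definition _ := GRing.Zmodule_isLmodule.Build A factor_mod
  factor_scaleA factor_scale1 factor_scaleDr factor_scaleDl.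

End FactorModule.

Section Modules.
Variable A : nzRingType.

Definition isomorphic_mod (M N : lmodType A) : Prop :=
  exists f : {linear M -> N}, bijective f.

Definition simple_mod (M : lmodType A) : Prop :=
  (exists x : M, x != 0) /\
  (forall N : submodClosed M,
     (forall x : M, x \in N -> x = 0) \/ (forall x : M, x \in N)).

Definition injective_mod (E : lmodType A) : Prop :=
  forall (M N : lmodType A) (i : {linear M -> N}) (g : {linear M -> E}),
    injective i -> exists h : {linear N -> E}, h \o i =1 g.

End Modules.

Definition right_Kasch (R : nzRingType) : Prop :=
  forall M : rmodType R, simple_mod M ->
    exists f : {linear M -> regular_rmod R}, injective f.

Definition right_dual_Kasch (R : nzRingType) : Prop :=
  forall M : rmodType R, simple_mod M ->
    exists (E : rmodType R) (N : submodClosed E),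
      injective_mod E /\ isomorphic_mod M (factor_mod N).

(* Functors Mod-R -> Mod-S; no additivity is required.  fmap_ext says that
   the action on morphisms respects the pointwise equality of morphisms. *)
Record rmod_functor (R S : nzRingType) := RmodFunctor {
  fobj :> rmodType R -> rmodType S;
  fmap : forall M N : rmodType R, {linear M -> N} -> {linear fobj M -> fobj N};
  fmap_ext : forall (M N : rmodType R) (f g : {linear M -> N}),
    f =1 g -> fmap f =1 fmap g;
  fmap_id : forall M : rmodType R, fmap (idfun : {linear M -> M}) =1 idfun;
  fmap_comp : forall (M N P : rmodType R)
      (f : {linear N -> P}) (g : {linear M -> N}),
    fmap (f \o g : {linear M -> P}) =1 fmap f \o fmap g
}.

Definition id_functor (R : nzRingType) : rmod_functor R R.
Proof. by refine (@RmodFunctor R R id (fun M N f => f) _ _ _). Defined.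

Definition comp_functor (R S T : nzRingType)
  (G : rmod_functor S T) (F : rmod_functor R S) : rmod_functor R T.
Proof.
refine (@RmodFunctor R T (fun M => G (F M))
          (fun M N f => fmap G (fmap F f)) _ _ _).
- by move=> M N f g fg; apply: fmap_ext; apply: fmap_ext.
- by move=> M x; rewrite (fmap_ext (fmap_id (r := F) (M := M))) fmap_id.
- by move=> M N P f g x; rewrite (fmap_ext (fmap_comp f g)) fmap_comp.
Defined.

Definition naturally_isomorphic (R S : nzRingType) (F G : rmod_functor R S) :
    Prop :=
  exists eta : forall M : rmodType R, {linear F M -> G M},
    (forall M : rmodType R, bijective (eta M)) /\
    (forall (M N : rmodType R) (f : {linear M -> N}),
       eta N \o fmap F f =1 fmap G f \o eta M).

Definition Morita_equivalent (R S : nzRingType) : Prop :=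
  exists (F : rmod_functor R S) (G : rmod_functor S R),
    naturally_isomorphic (comp_functor G F) (id_functor R) /\
    naturally_isomorphic (comp_functor F G) (id_functor S).

(* Main.v *)
From HB Require Import structures.
Require Import Defs.
From mathcomp Require Import all_boot all_order all_algebra.
From mathcomp Require Import boolp.

Set Implicit Arguments.
Unset Strict Implicit.
Unset Printing Implicit Defensive.

Import GRing.Theory.
Local Open Scope ring_scope.
Local Open Scope quotient_scope.

(** Both Kasch conditions are rephrased so that they only speak of nonzero
    maps, injective maps, simple modules and injective modules, and each of
    these notions is shown to survive an equivalence F with quasi-inverse G.
    The functors are not assumed additive, so even zero maps need an argument.

    Elements of a module M are the maps from the regular module to M. Testing
    against pairs of such maps, a faithful functor reflects zero maps and
    injective maps ([faithful_zero], [faithful_injective]). As G (F f) is a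
    conjugate of f, the functor F also preserves them ([equiv_zero],
    [equiv_injective]). A nonzero module is simple exactly when each nonzero
    map out of it is injective, so simplicity is preserved as well
    ([equiv_simple]); injectivity of modules passes through because F is full
    ([equiv_injective_mod]).

    Dual Kasch: a map onto a simple module is the same as a nonzero map, so
    the condition asks for a nonzero map from an injective module to each
    simple one. For a simple S-module T, take such a map E -> G T and apply F.

    Kasch: an embedding of a simple module is the same as a nonzero map. For a
    simple S-module T, the R-module G T embeds in the regular module of R. It
    remains to reach G S instead, where S is the regular module. Now G S is
    again a separator (a generator), because F is faithful, and a separator is
    a faithful module ([separator_faithful]). So if f m is a nonzero element
    of R in the image of the embedding f, it acts nontrivially on some p in
    G S, and composing f with the map sending 1 to p yields a nonzero map from
    G T to G S ([separator_hom_neq0]). By fullness of G it comes from a nonzero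
    map T -> S. *)

(** * Modules over a ring *)

Section Modules.
Variable A : nzRingType.
Implicit Types M N E P : lmodType A.

Section OrbitMap.
Variables (M : lmodType A) (x : M).

Definition orbit_map (r : A^o) : M := (r : A) *: x.

Fact orbit_map_linear : linear orbit_map.
Proof. by move=> a r s; rewrite /orbit_map scalerDl -scalerA. Qed.

HB.instance Definition _ :=
  GRing.isLinear.Build A A^o M *:%R orbit_map orbit_map_linear.

Lemma orbit_map1 : orbit_map 1 = x.
Proof. exact: scale1r. Qed.

End OrbitMap.

(** Bijectivity only provides an inverse function; inverses of the components
    of a natural isomorphism are needed as morphisms. *)
Lemma linear_inverse M N (f : {linear M -> N}) :
  bijective f -> exists g : {linear N -> M}, cancel f g /\ cancel g f.
Proof.
case=> g fK gK.
have lin : linear g by move=> a x y; rewrite -[in LHS](gK x) -(gK y) -linearP fK.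
pose gl : {linear N -> M} := HB.pack g (GRing.isLinear.Build A N M *:%R g lin).
by exists gl.
Qed.

(** Submodules are boolean predicates, whereas the kernels, images and
    annihilators below are only propositions; excluded middle bridges the gap. *)
Lemma submodule_of M (p : M -> Prop) :
    p 0 -> (forall x y, p x -> p y -> p (x + y)) ->
    (forall a x, p x -> p (a *: x)) ->
  exists N : submodClosed M, forall x, x \in N <-> p x.
Proof.
move=> p0 pD pZ; pose S : {pred M} := fun x => `[< p x >].
have inS x : x \in S <-> p x by rewrite unfold_in; split=> /asboolP.
have S_closed : GRing.subsemimod_closed S.
  split; first by split=> [|x y /inS px /inS py]; apply/inS => //; apply: pD.
  by move=> a x /inS px; apply/inS/pZ.
pose N : submodClosed M :=
  HB.pack S (GRing.isSubmodClosed.Build A M S S_closed).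
by exists N.
Qed.

Lemma factor_map M (N : submodClosed M) :
  exists p : {linear M -> factor_mod N},
    (forall x, p x = 0 <-> x \in N) /\ (forall q, exists x, p x = q).
Proof.
pose p x := \pi_(factor_mod N) x.
have lin : linear p by move=> a x y; rewrite /p raddfD /= pi_factor_scale.
pose pl : {linear M -> factor_mod N} :=
  HB.pack p (GRing.isLinear.Build A M (factor_mod N) *:%R p lin).
exists pl; split=> [x|]; last by elim/quotW=> x; exists x.
rewrite -[X in _ <-> is_true X]/(x \in submod_pred N).
rewrite -[X in _ <-> is_true (X \in _)]subr0 Quotient.idealrBE raddf0.
by split=> /eqP.
Qed.

Lemma first_isomorphism E M (f : {linear E -> M}) :
  (forall y, exists x, f x = y) ->
  exists N : submodClosed E, isomorphic_mod M (factor_mod N).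
Proof.
move=> f_surj.
have [||| N inN] := @submodule_of E (fun x => f x = 0).
- exact: linear0.
- by move=> x y fx fy; rewrite linearD fx fy addr0.
- by move=> a x fx; rewrite linearZ /= fx scaler0.
exists N; pose g (q : factor_mod N) := f (repr q).
(* g does not depend on the representative: two of them differ by an element
   of N, the kernel of f. *)
have gE x : g (\pi_(factor_mod N) x) = f x.
  apply/esym/eqP; rewrite -subr_eq0 -linearB; apply/eqP/inN.
  rewrite -[is_true _]/(is_true (_ \in submod_pred N)).
  by rewrite Quotient.idealrBE reprK.
have lin : linear g.
  move=> a; elim/quotW=> x; elim/quotW=> y.
  have -> : a *: \pi_(factor_mod N) x + \pi_(factor_mod N) y
            = \pi_(factor_mod N) (a *: x + y).
    by rewrite raddfD /= pi_factor_scale.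
  by rewrite !gE linearP.
pose gl : {linear factor_mod N -> M} :=
  HB.pack g (GRing.isLinear.Build A (factor_mod N) M *:%R g lin).
have f_surjb y : exists x, f x == y by have [x <-] := f_surj y; exists x.
have g_bij : bijective gl.
  exists (fun y => \pi_(factor_mod N) (xchoose (f_surjb y))).
    elim/quotW=> x /=; rewrite gE.
    set y := xchoose _; have /eqP fy := xchooseP (f_surjb (f x)); rewrite -/y in fy.
    apply/eqP; rewrite -Quotient.idealrBE; apply/inN.
    by rewrite linearB fy subrr.
  by move=> y; rewrite /= gE; apply/eqP/(xchooseP (f_surjb y)).
have [h [gK hK]] := linear_inverse g_bij.
by exists h, gl.
Qed.

Lemma linear_injective M N (f : {linear M -> N}) :
  (forall x, f x = 0 -> x = 0) -> injective f.
Proof.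
move=> f0 x y fxy; apply/eqP; rewrite -subr_eq0; apply/eqP/f0.
by rewrite linearB fxy subrr.
Qed.

Lemma simple_hom_injective M N (f : {linear M -> N}) :
  simple_mod M -> ~ f =1 (fun=> 0) -> injective f.
Proof.
move=> [_ Msimple] f_neq0; apply: linear_injective.
have [||| K inK] := @submodule_of M (fun x => f x = 0).
- exact: linear0.
- by move=> x y fx fy; rewrite linearD fx fy addr0.
- by move=> a x fx; rewrite linearZ /= fx scaler0.
have [K0 x /inK /K0 //|KT] := Msimple K.
by case: f_neq0 => x; apply/inK.
Qed.

Lemma simple_hom_surjective E M (f : {linear E -> M}) :
  simple_mod M -> ~ f =1 (fun=> 0) -> forall y, exists x, f x = y.
Proof.
move=> [_ Msimple] f_neq0.
have [||| I inI] := @submodule_of M (fun y => exists x, f x = y).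
- by exists 0; exact: linear0.
- by move=> _ _ [x <-] [y <-]; exists (x + y); rewrite linearD.
- by move=> a _ [x <-]; exists (a *: x); rewrite linearZ.
have [I0|IT y] := Msimple I; last exact/inI.
by case: f_neq0 => x; apply/I0/inI; exists x.
Qed.

(** Apply the hypothesis to the projection onto a factor module: if it is
    zero, the submodule is everything; if it is injective, the submodule is
    zero. The criterion mentions no submodule, so that it can be moved along a functor. *)
Lemma simple_of_homs M :
    (exists x : M, x != 0) ->
    (forall N (f : {linear M -> N}), ~ f =1 (fun=> 0) -> injective f) ->
  simple_mod M.
Proof.
move=> Mneq0 Mhom; split=> // N; have [p [pN _]] := factor_map N.
have [p0|/Mhom p_inj] := pselect (p =1 (fun=> 0)).
  by right=> x; apply/pN.
by left=> x /pN px; apply: p_inj; rewrite px linear0.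
Qed.

(** Being a factor of E amounts, for a simple module, to receiving a nonzero map
    from E: conversely such a map is onto by [simple_hom_surjective], and
    [first_isomorphism] applies. *)
Lemma simple_factor_hom_neq0 M E (N : submodClosed E) :
  simple_mod M -> isomorphic_mod M (factor_mod N) ->
  exists f : {linear E -> M}, ~ f =1 (fun=> 0).
Proof.
move=> [[x /eqP x_neq0] _] [g g_bij].
have [h [gK hK]] := linear_inverse g_bij.
have [p [_ p_surj]] := factor_map N.
exists (h \o p) => hp0; apply: x_neq0.
by have [y py] := p_surj (g x); rewrite -(gK x) -py; apply: hp0.
Qed.

Definition separator P : Prop :=
  forall M N (f g : {linear M -> N}),
    (forall h : {linear P -> M}, f \o h =1 g \o h) -> f =1 g.

Lemma regular_separator : separator A^o.
Proof. by move=> M N f g fg x; rewrite -(orbit_map1 x); apply: fg. Qed.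

(** Let I be the set of r such that a t r = 0 for all t. If a kills P, every
    map from P to the regular module has its image in I, hence cannot tell the
    projection modulo I from the zero map. So that projection is zero, I
    contains 1, and a = 0. *)
Lemma separator_faithful P (a : A) :
  separator P -> (forall p : P, a *: p = 0) -> a = 0.
Proof.
move=> sepP aP.
have [||| I inI] := @submodule_of A^o (fun r => forall t : A, a * t * (r : A) = 0).
- by move=> t; rewrite mulr0.
- by move=> x y Ix Iy t; rewrite mulrDr Ix Iy addr0.
- by move=> b x Ix t; rewrite -[b *: x]/(b * x) mulrA -(mulrA a) Ix.
have [pi [piI _]] := factor_map I.
have /(_ (1 : A)) pi0 : pi =1 (\0 : {linear A^o -> factor_mod I}).
  apply: sepP => h p; apply/piI/inI => t.
  by rewrite -[_ * _]/((a * t) *: h p) -linearZ /= -scalerA aP linear0.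
by move/piI/inI/(_ 1): pi0; rewrite !mulr1.
Qed.

(** For f m <> 0, some p in P has f m *: p <> 0 by faithfulness; follow f by
    the map r |-> r *: p. *)
Lemma separator_hom_neq0 P M (f : {linear M -> A^o}) :
  separator P -> ~ f =1 (fun=> 0) ->
  exists g : {linear M -> P}, ~ g =1 (fun=> 0).
Proof.
move=> sepP /existsNP[m fm_neq0]; apply: contrapT => no_hom.
apply: fm_neq0; apply: (separator_faithful sepP) => p.
apply: contrapT => fmp; apply: no_hom.
by exists (orbit_map p \o f) => /(_ m).
Qed.

End Modules.

(** * Faithful functors *)

Section Functors.
Variables R S : nzRingType.

Definition faithful (F : rmod_functor R S) : Prop :=
  forall (M N : rmodType R) (f g : {linear M -> N}),
    fmap F f =1 fmap F g -> f =1 g.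

Section Reflect.
Variables (F : rmod_functor R S) (F_faithful : faithful F).
Variables (M N : rmodType R) (f : {linear M -> N}).

(** Since no additivity is known, the zero map is recognised as the one whose
    composites with the maps picking x and 0 agree. *)
Lemma faithful_zero : fmap F f =1 (fun=> 0) -> f =1 (fun=> 0).
Proof.
move=> Ff0 x.
have /F_faithful/(_ 1) :
    fmap F (f \o orbit_map x : {linear regular_rmod R -> N})
    =1 fmap F (f \o orbit_map 0 : {linear regular_rmod R -> N}).
  by move=> y; rewrite !fmap_comp /= !Ff0.
by rewrite /= !orbit_map1 linear0.
Qed.

(** An injective map is left-cancellable, and the images of two maps that pick
    elements x and y with f x = f y are cancelled by F f. *)
Lemma faithful_injective : injective (fmap F f) -> injective f.
Proof.
move=> Ff_inj x y fxy.
have /F_faithful/(_ 1): fmap F (orbit_map x : {linear regular_rmod R -> M})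
    =1 fmap F (orbit_map y : {linear regular_rmod R -> M}).
  move=> z; apply: Ff_inj; rewrite -[LHS]fmap_comp -[RHS]fmap_comp.
  by apply: fmap_ext => r /=; rewrite /orbit_map !linearZ /= fxy.
by rewrite /= !orbit_map1.
Qed.

End Reflect.
End Functors.

(** * Equivalences *)

Definition left_inverse_functor (R S : nzRingType)
    (F : rmod_functor R S) (G : rmod_functor S R) : Prop :=
  naturally_isomorphic (comp_functor G F) (id_functor R).

Lemma left_inverse_faithful (R S : nzRingType)
    (F : rmod_functor R S) (G : rmod_functor S R) :
  left_inverse_functor F G -> faithful F.
Proof.
move=> [eta [eta_bij eta_nat]] M N f g Ffg x.
have [eta' _ etaK] := eta_bij M; rewrite -(etaK x).
have /= Ef := eta_nat M N f (eta' x); have /= Eg := eta_nat M N g (eta' x).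
by rewrite -Ef -Eg (fmap_ext Ffg).
Qed.

Section Equivalence.
Variables (R S : nzRingType).
Variables (F : rmod_functor R S) (G : rmod_functor S R).
Hypotheses (GF : left_inverse_functor F G) (FG : left_inverse_functor G F).

Let F_faithful : faithful F := left_inverse_faithful GF.
Let G_faithful : faithful G := left_inverse_faithful FG.

(** The candidate is G w conjugated by the natural isomorphism from G F to the
    identity; G sends F of it and w to the same map, and G is faithful. *)
Lemma equiv_full (M N : rmodType R) (w : {linear F M -> F N}) :
  exists f : {linear M -> N}, fmap F f =1 w.
Proof.
have [eta [eta_bij eta_nat]] := GF.
have [eta' [etaK etaK']] := linear_inverse (eta_bij M).
exists (eta N \o fmap G w \o eta').
apply: G_faithful => x; apply: (bij_inj (eta_bij N)).
by have /= -> := eta_nat _ _ (eta N \o fmap G w \o eta') x; rewrite etaK.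
Qed.

Lemma equiv_zero (M N : rmodType R) (f : {linear M -> N}) :
  f =1 (fun=> 0) -> fmap F f =1 (fun=> 0).
Proof.
move=> f0; apply: (faithful_zero G_faithful) => x.
have [eta [eta_bij eta_nat]] := GF.
apply: (bij_inj (eta_bij N)); rewrite linear0.
by have /= -> := eta_nat M N f x; apply: f0.
Qed.

Lemma equiv_injective (M N : rmodType R) (f : {linear M -> N}) :
  injective f -> injective (fmap F f).
Proof.
move=> f_inj; apply: (faithful_injective G_faithful) => x y GFxy.
have [eta [eta_bij eta_nat]] := GF.
apply: (bij_inj (eta_bij M)); apply: f_inj.
have /= <- := eta_nat M N f x; have /= <- := eta_nat M N f y.
by rewrite GFxy.
Qed.

(** A map f out of F M gives a map G f out of a copy of M, which is injective
    as soon as it is nonzero; faithfulness of G carries this back to f. *)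
Lemma equiv_simple (M : rmodType R) : simple_mod M -> simple_mod (F M).
Proof.
move=> Msimple; apply: simple_of_homs => [|N f f_neq0].
  have [[x /eqP x_neq0] _] := Msimple; apply: contrapT => FM0; apply: x_neq0.
  apply: (faithful_zero F_faithful (f := idfun : {linear M -> M})) => y.
  by rewrite fmap_id; apply: contrapT => /eqP y_neq0; apply: FM0; exists y.
have [eta [eta_bij eta_nat]] := GF.
have [eta' [etaK etaK']] := linear_inverse (eta_bij M).
apply: (faithful_injective G_faithful).
have Gf_inj : injective (fmap G f \o eta').
  apply: simple_hom_injective => // Gf0; apply: f_neq0.
  apply: (faithful_zero G_faithful) => x.
  by have := Gf0 (eta M x); rewrite /= etaK.
move=> x y Gfxy; apply: (bij_inj (eta_bij M)); apply: Gf_inj.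
by rewrite /= !etaK.
Qed.

(** To compare f and g on M, compare F f and F g on elements of F M, that is on
    maps S -> F M; under G these become maps G S -> G (F M), and G (F M) is M. *)
Lemma equiv_separator : separator (G (regular_rmod S)).
Proof.
have [eta [eta_bij eta_nat]] := GF.
move=> M N f g fg; apply: F_faithful; apply: regular_separator => h.
apply: G_faithful => x; rewrite !fmap_comp; apply: (bij_inj (eta_bij N)).
have /= -> := eta_nat M N f (fmap G h x); have /= -> := eta_nat M N g (fmap G h x).
exact: (fg (eta M \o fmap G h)).
Qed.

End Equivalence.

Section InjectiveModules.
Variables (R S : nzRingType).
Variables (F : rmod_functor R S) (G : rmod_functor S R).
Hypotheses (GF : left_inverse_functor F G) (FG : left_inverse_functor G F).

(** An extension problem into F E is sent by G to one into E; its solution is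
    brought back by fullness of G. *)
Lemma equiv_injective_mod (E : rmodType R) :
  injective_mod E -> injective_mod (F E).
Proof.
have [eta [eta_bij eta_nat]] := GF.
have [eta' [etaK etaK']] := linear_inverse (eta_bij E).
move=> Einj M N i g i_inj.
have Gi_inj := equiv_injective FG GF i_inj.
have [h hE] := Einj _ _ (fmap G i) (eta E \o fmap G g) Gi_inj.
have [k Gk] := equiv_full FG GF (eta' \o h).
exists k; apply: (left_inverse_faithful FG) => x.
have /= hi := hE x.
by rewrite fmap_comp /= Gk /= hi etaK.
Qed.

End InjectiveModules.

(** * Transfer of the Kasch conditions *)

Lemma right_Kasch_transfer (R S : nzRingType)
    (F : rmod_functor R S) (G : rmod_functor S R) :
  left_inverse_functor F G -> left_inverse_functor G F ->
  right_Kasch R -> right_Kasch S.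
Proof.
move=> GF FG kaschR T Tsimple.
have GTsimple := equiv_simple FG GF Tsimple.
have [f f_inj] := kaschR _ GTsimple.
have f_neq0 : ~ f =1 (fun=> 0).
  have [[x /eqP x_neq0] _] := GTsimple => f0; apply: x_neq0.
  by apply: f_inj; rewrite f0 linear0.
have [g g_neq0] := separator_hom_neq0 (equiv_separator GF FG) f_neq0.
have [k Gk] := equiv_full FG GF g.
exists k; apply: simple_hom_injective => // k0; apply: g_neq0 => x.
by rewrite -Gk (equiv_zero FG GF k0).
Qed.

Lemma right_dual_Kasch_transfer (R S : nzRingType)
    (F : rmod_functor R S) (G : rmod_functor S R) :
  left_inverse_functor F G -> left_inverse_functor G F ->
  right_dual_Kasch R -> right_dual_Kasch S.
Proof.
move=> GF FG kaschR T Tsimple.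
have GTsimple := equiv_simple FG GF Tsimple.
have [E [K [Einj GT_iso]]] := kaschR _ GTsimple.
have [f f_neq0] := simple_factor_hom_neq0 GTsimple GT_iso.
have [eps [eps_bij _]] := FG.
have f_surj : forall y, exists x, (eps T \o fmap F f) x = y.
  apply: simple_hom_surjective => // epsf0; apply: f_neq0.
  apply: (faithful_zero (left_inverse_faithful GF)) => x.
  apply: (bij_inj (eps_bij T)); rewrite linear0; exact: epsf0.
have [N T_iso] := first_isomorphism f_surj.
by exists (F E), N; split=> //; apply: (equiv_injective_mod GF FG).
Qed.

Theorem corollary2p2 (R S : nzRingType) (hRS : Morita_equivalent R S) :
  (right_Kasch R <-> right_Kasch S) /\
  (right_dual_Kasch R <-> right_dual_Kasch S).
Proof.
have [F [G [GF FG]]] := hRS.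
split; split.
- exact: right_Kasch_transfer GF FG.
- exact: right_Kasch_transfer FG GF.
- exact: right_dual_Kasch_transfer GF FG.
- exact: right_dual_Kasch_transfer FG GF.
Qed.
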